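(* Let $P(G;X_1,\ldots,X_r)$ and $Q(G;Y_1,\ldots,Y_s)$ be two graph polynomials with integer coefficients, with coefficient sequences $cP(G), cQ(G)\in\mathbb{Z}^{\infty}$. Then $P$ and $Q$ are d.p.-equivalent if and only if there are two functions $F_1,F_2:\mathbb{Z}^{\infty}\to\mathbb{Z}^{\infty}$ such that for every graph $G$ $$F_1(n(G),m(G),k(G),cP(G))=cQ(G)\quad\text{and}\quad F_2(n(G),m(G),k(G),cQ(G))=cP(G).$$
   Context: Graphs are finite, simple and undirected; $n(G)$, $m(G)$, $k(G)$ denote the numbers of vertices, edges and connected components of $G$. A graph parameter is a function on graphs invariant under isomorphism. A graph polynomial is a graph invariant of the form $P(G;X_1,\ldots,X_r)=\sum_{i_1,\ldots,i_r=0}^{s(G)}h_{i_1,\ldots,i_r}(G)X_1^{i_1}\cdots X_r^{i_r}$, where $s(G)$ is a graph parameter with non-negative integer values and the $h_{i_1,\ldots,i_r}(G)$ are integer-valued graph parameters. Two graphs $G_1,G_2$ are similar if $n(G_1)=n(G_2)$, $m(G_1)=m(G_2)$ and $k(G_1)=k(G_2)$. Two graph polynomials $P$ and $Q$ are d.p.-equivalent if for every two similar graphs $G_1,G_2$: $P(G_1;\bar X)=P(G_2;\bar X)$ if and only if $Q(G_1;\bar Y)=Q(G_2;\bar Y)$ (equality of polynomials). $\mathbb{Z}^{\infty}$ is the set of finite sequences of integers. $cP(G)\in\mathbb{Z}^\infty$ is the sequence of coefficients of the polynomial $P(G;\bar X)$, listed according to a fixed convention such that the sequence and the polynomial determine each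 other. $(n(G),m(G),k(G),cP(G))$ denotes the sequence obtained by prepending the three integers to $cP(G)$. *)

(* Defs.v *)
From mathcomp Require Import all_boot all_order all_algebra.
From mathcomp Require Import mpoly.

Set Implicit Arguments.
Unset Strict Implicit.
Unset Printing Implicit Defensive.

Import GRing.Theory.
Local Open Scope ring_scope.

Record sgraph := SGraph {
  vertex :> finType;
  adj : rel vertex;
  adj_sym : ssrbool.symmetric adj;
  adj_irrefl : irreflexive adj
}.

Definition isomorphic (G H : sgraph) : Prop :=
  exists f : G -> H, bijective f /\ forall x y, adj (f x) (f y) = adj x y.

Definition graph_parameter (T : Type) (f : sgraph -> T) : Prop :=
  forall G H : sgraph, isomorphic G H -> f G = f H.

Definition edges (G : sgraph) : {set {set G}} :=
  [set [set xy.1; xy.2] | xy in [set xy : G * G | adj xy.1 xy.2]].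

Definition nv (G : sgraph) : nat := #|G|.
Definition ne (G : sgraph) : nat := #|edges G|.
Definition nc (G : sgraph) : nat := n_comp (@adj G) predT.

Definition similar (G H : sgraph) : Prop :=
  [/\ nv G = nv H, ne G = ne H & nc G = nc H].

(* The multi-indices (i_1, ..., i_r) with 0 <= i_j <= s, in a fixed order. *)
Definition box (r s : nat) : seq 'X_{1..r} :=
  [seq [multinom (i j : nat) | j < r]
  | i : {ffun 'I_r -> 'I_s.+1} <- enum {ffun 'I_r -> 'I_s.+1}].

Definition graph_polynomial (r : nat) (P : sgraph -> {mpoly int[r]}) : Prop :=
  graph_parameter P /\
  exists (s : sgraph -> nat) (h : 'X_{1..r} -> sgraph -> int),
    [/\ graph_parameter s,
        forall i, graph_parameter (h i)
      & forall G, P G = \sum_(i <- box r (s G)) h i G *: 'X_[i]].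

Definition dp_equivalent (r s : nat)
    (P : sgraph -> {mpoly int[r]}) (Q : sgraph -> {mpoly int[s]}) : Prop :=
  forall G1 G2 : sgraph, similar G1 G2 -> (P G1 = P G2 <-> Q G1 = Q G2).

(* A convention for listing the coefficients of integer polynomials: c r p is
   the list of the coefficients of p at some repetition-free list of monomials
   that contains all those occurring in p, and it determines p.  Which
   monomials are listed, and in which order, is left to the convention and may
   depend on p. *)
Definition coef_convention (c : forall r, {mpoly int[r]} -> seq int) : Prop :=
  forall r, injective (c r) /\
    forall p : {mpoly int[r]}, exists ms : seq 'X_{1..r},
      [/\ uniq ms, {subset msupp p <= ms} & c r p = [seq p@_m | m <- ms]].

Definition with_nmk (G : sgraph) (u : seq int) : seq int :=
  [:: (nv G)%:Z, (ne G)%:Z, (nc G)%:Z & u].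

(* Such conventions exist: list the coefficients over the smallest box
   {0, ..., d}^r containing the exponents of p. *)
Definition box_degree (r : nat) (p : {mpoly int[r]}) : nat :=
  \max_(m <- msupp p) \max_(i < r) m i.

Definition box_coefs (r : nat) (p : {mpoly int[r]}) : seq int :=
  [seq p@_m | m <- box r (box_degree p)].

Lemma box_uniq r s : uniq (box r s).
Proof.
rewrite map_inj_uniq ?enum_uniq // => f g /mnmP efg.
by apply/ffunP => j; apply/val_inj; have := efg j; rewrite !mnmE.
Qed.

Lemma size_box r s : size (box r s) = (s.+1 ^ r)%N.
Proof. by rewrite size_map -cardT card_ffun !card_ord. Qed.

Lemma mem_box r s (m : 'X_{1..r}) : (forall i, m i <= s)%N -> m \in box r s.
Proof.
move=> ms; apply/mapP; exists [ffun i => inord (m i)]; first by rewrite mem_enum.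
by apply/mnmP => i; rewrite mnmE ffunE inordK // ltnS.
Qed.

Lemma msupp_box r (p : {mpoly int[r]}) :
  {subset msupp p <= box r (box_degree p)}.
Proof.
move=> m mp; apply: mem_box => i.
rewrite /box_degree (big_rem m) //=.
by apply: leq_trans (leq_maxl _ _); apply: (leq_bigmax i).
Qed.

Lemma box_coefs_convention : coef_convention box_coefs.
Proof.
move=> r; split=> [p q|p]; last first.
  by exists (box r (box_degree p)); split; [exact: box_uniq|exact: msupp_box|].
move=> epq; have edeg : box_degree p = box_degree q.
  have := congr1 size epq; rewrite size_map size_box size_map size_box.
  case: r p q {epq} => [|r] p q; last by move/eqP; rewrite eqn_exp2r // => /eqP[].
  by rewrite /box_degree !big1_seq // => m _; rewrite big_ord0.
have /eq_in_map epqm : box_coefs p = [seq q@_m | m <- box r (box_degree p)].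
  by rewrite epq /box_coefs edeg.
apply/mpolyP => m; have [/epqm//|nm] := boolP (m \in box r (box_degree p)).
rewrite !memN_msupp_eq0 //; apply: contra nm => /msupp_box //.
by rewrite edeg.
Qed.

(* Main.v *)
(** Both directions express one fact: a map [psi] factors through a map [phi]
    exactly when [phi x = phi y] implies [psi x = psi y].  Take
    [phi G = (n(G), m(G), k(G), cP(G))] and [psi G = cQ(G)]: since [cP(G)]
    determines [P(G)], equality of [phi] at two graphs means that they are
    similar with the same [P]. *)
Require Import Defs.
From mathcomp Require Import all_boot all_order all_algebra.
From mathcomp Require Import mpoly.
From Stdlib Require Import ClassicalEpsilon.

Lemma factor_through (A B C : Type) (phi : A -> B) (psi : A -> C) (c0 : C) :
  (forall x y, phi x = phi y -> psi x = psi y) ->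
  exists F : B -> C, forall x, F (phi x) = psi x.
Proof.
move=> kernel_le.
(* [epsilon] picks the [psi]-value of some preimage of [b]; off the image of [phi] the value is
   arbitrary, with [c0] witnessing that [C] is inhabited. *)
pose F b := epsilon (inhabits c0) (fun c => exists2 x, phi x = b & psi x = c).
exists F => x; rewrite /F.
have [|y ey <-] := epsilon_spec (inhabits c0)
  (fun c => exists2 y, phi y = phi x & psi y = c); first by exists (psi x), x.
exact: kernel_le.
Qed.

Lemma with_nmk_eq (G H : sgraph) (u v : seq int) :
  with_nmk G u = with_nmk H v <-> Defs.similar G H /\ u = v.
Proof.
by split=> [[en em ek ->]|[[en em ek] ->]]; [split | rewrite /with_nmk en em ek].
Qed.

Theorem proposition1p1
  (coefs : forall r : nat, {mpoly int[r]} -> seq int)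
  (Hcoefs : coef_convention coefs)
  (r s : nat)
  (P : sgraph -> {mpoly int[r]}) (Q : sgraph -> {mpoly int[s]})
  (HP : graph_polynomial P) (HQ : graph_polynomial Q) :
  dp_equivalent P Q <->
  exists F1 F2 : seq int -> seq int,
    forall G : sgraph,
      F1 (with_nmk G (coefs r (P G))) = coefs s (Q G) /\
      F2 (with_nmk G (coefs s (Q G))) = coefs r (P G).
Proof.
have coefs_inj t : injective (coefs t) by case: (Hcoefs t).
split=> [PQ | [F1 [F2 F12]] G H simGH].
- have [|F1 F1E] := @factor_through _ _ _
    (fun G => with_nmk G (coefs r (P G))) (fun G => coefs s (Q G)) [::].
    by move=> G H /with_nmk_eq[simGH /coefs_inj/(PQ _ _ simGH) ->].
  have [|F2 F2E] := @factor_through _ _ _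
    (fun G => with_nmk G (coefs s (Q G))) (fun G => coefs r (P G)) [::].
    (* Here [PQ] is used from right to left. *)
    by move=> G H /with_nmk_eq[simGH /coefs_inj/(PQ _ _ simGH) ->].
  by exists F1, F2.
- have [F1G F2G] := F12 G; have [F1H F2H] := F12 H.
  (* For similar graphs, [e] makes the two arguments of [F1] (then [F2]) equal, hence also the
     coefficient lists they return. *)
  split=> e; apply: coefs_inj.
    by rewrite -F1G -F1H; congr F1; apply/with_nmk_eq; rewrite e.
  by rewrite -F2G -F2H; congr F2; apply/with_nmk_eq; rewrite e.
Qed.
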